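(* Let $G$ be a Polish group and assume that its universal minimal flow $M(G)$ is metrizable. Suppose that $G$ is strongly amenable and minimally almost periodic. Then $G$ is extremely amenable.
   Context: A $G$-flow is a continuous action of a topological group $G$ on a (nonempty) compact Hausdorff space $X$; it is minimal when every orbit is dense. A flow maps onto another one when there is a continuous $G$-equivariant surjection from the first to the second. The universal minimal flow $M(G)$ is the (unique up to isomorphism) minimal $G$-flow that maps onto every minimal $G$-flow. A pair $(x,y)\in X^2$ is proximal when there is a net $(g_\alpha)_\alpha$ in $G$ with $\lim_\alpha g_\alpha\cdot x=\lim_\alpha g_\alpha\cdot y$. A flow $X$ is proximal when every pair in $X^2$ is proximal. The flow $X$ is equicontinuous when for every $x\in X$ and every entourage $\epsilon$ of the uniformity of $X$ there is a neighborhood $U$ of $x$ such that $(g\cdot x,g\cdot y)\in\epsilon$ for all $g\in G$, $y\in U$. $\Pi(G)$ denotes the universal minimal proximal flow of $G$ (the unique minimal proximal flow mapping onto every minimal proximal flow), and $B(G)$ the universal minimal equicontinuous flow of $G$ (defined likewise within equicontinuous flows); $B(G)$ is the Bohr compactification of $G$ viewed as a $G$-flow. $G$ is strongly amenable when $\Pi(G)$ is a single point; minimally almost periodic when $B(G)$ is a single point; extremely amenable when every $G$-flow has a fixed point (equivalently, $M(G)$ is a single point). *)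

(* Defs.v *)
From HB Require Import structures.
From mathcomp Require Import all_boot all_order all_algebra.
From mathcomp Require Import all_classical all_reals all_analysis.

Set Implicit Arguments.
Unset Strict Implicit.
Unset Printing Implicit Defensive.

Local Open Scope classical_set_scope.

HB.structure Definition PreTopologicalGroup := {G of Topological G & Group G}.

HB.mixin Record PreTopologicalGroup_isTopologicalGroup G
    & PreTopologicalGroup G := {
  mulg_continuous : continuous (fun p : G * G => (p.1 * p.2)%g) ;
  invg_continuous : continuous (fun x : G => (x^-1)%g)
}.

#[short(type="topologicalGroupType")]
HB.structure Definition TopologicalGroup :=
  {G of PreTopologicalGroup G & PreTopologicalGroup_isTopologicalGroup G}.

Definition homeomorphic (S T : topologicalType) : Prop :=
  exists (f : S -> T) (h : T -> S),
    [/\ continuous f, continuous h, cancel f h & cancel h f].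

Definition separable (T : topologicalType) : Prop :=
  exists2 D : set T, countable D & dense D.

Definition complete (T : uniformType) : Prop :=
  forall F : set_system T, ProperFilter F -> cauchy F -> exists x : T, F --> x.

Definition metrizable (R : realType) (T : topologicalType) : Prop :=
  exists M : metricType R, homeomorphic T M.

Definition polish (R : realType) (T : topologicalType) : Prop :=
  separable T /\ exists M : metricType R, homeomorphic T M /\ complete M.

Record flow (G : topologicalGroupType) := Flow {
  flow_space :> topologicalType ;
  flow_act : G -> flow_space -> flow_space ;
  flow_act1 : forall x, flow_act 1%g x = x ;
  flow_actM : forall g h x,
    flow_act (g * h)%g x = flow_act g (flow_act h x) ;
  flow_act_continuous :
    continuous (fun p : G * flow_space => flow_act p.1 p.2) ;
  flow_nonempty : [set: flow_space] !=set0 ;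
  flow_compact : compact [set: flow_space] ;
  flow_hausdorff : hausdorff_space flow_space
}.

Section Flows.
Context {G : topologicalGroupType}.
Implicit Types X Y M : flow G.

Definition orbit X (x : X) : set X := range (fun g => flow_act g x).

Definition minimal X : Prop := forall x : X, dense (orbit x).

Definition maps_onto X Y : Prop :=
  exists f : X -> Y,
    [/\ continuous f,
        forall g x, f (flow_act g x) = flow_act g (f x)
      & forall y, exists x, f x = y].

Definition universal_in (K : flow G -> Prop) M : Prop :=
  K M /\ forall X, K X -> maps_onto M X.

Definition universal_minimal_flow M : Prop := universal_in minimal M.

Definition directed (I : Type) (le : I -> I -> Prop) : Prop :=
  [/\ inhabited I, forall i, le i i,
      forall i j k, le i j -> le j k -> le i k
    & forall i j, exists k, le i k /\ le j k].

(* A net indexed by [I] converges when its image of this filter does. *)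
Definition tails (I : Type) (le : I -> I -> Prop) : set_system I :=
  filter_from [set: I] (fun i => [set j | le i j]).

Definition proximal_pair X (x y : X) : Prop :=
  exists (I : Type) (le : I -> I -> Prop) (g : I -> G) (z : X),
    [/\ directed le,
        (fun i => flow_act (g i) x) @ tails le --> z
      & (fun i => flow_act (g i) y) @ tails le --> z].

Definition proximal X : Prop := forall x y : X, proximal_pair x y.

(* The axioms of [uniformType], for a uniformity inducing the given topology. *)
Definition is_uniformity (T : topologicalType) (U : set_system (T * T)) : Prop :=
  [/\ Filter U,
      forall A, U A -> diagonal `<=` A,
      forall A, U A -> U (A^-1)%relation,
      forall A, U A -> exists2 B, U B & (B \; B)%relation `<=` A
    & nbhs = nbhs_ U].

(* A compact Hausdorff space carries exactly one compatible uniformity, so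
   quantifying over [U] amounts to speaking of the uniformity of [X]. *)
Definition equicontinuous_flow X : Prop :=
  forall U : set_system (X * X), is_uniformity U ->
  forall (x : X) (E : set (X * X)), U E ->
    \forall y \near x, forall g : G, E (flow_act g x, flow_act g y).

Definition universal_minimal_proximal_flow M : Prop :=
  universal_in (fun X => minimal X /\ proximal X) M.

Definition universal_minimal_equicontinuous_flow M : Prop :=
  universal_in (fun X => minimal X /\ equicontinuous_flow X) M.

Definition single_point X : Prop := exists x : X, [set: X] = [set x].

End Flows.

Definition strongly_amenable (G : topologicalGroupType) : Prop :=
  exists P : flow G, universal_minimal_proximal_flow P /\ single_point P.

Definition minimally_almost_periodic (G : topologicalGroupType) : Prop :=
  exists B : flow G, universal_minimal_equicontinuous_flow B /\ single_point B.

Definition extremely_amenable (G : topologicalGroupType) : Prop :=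
  forall X : flow G, exists x : X, forall g : G, flow_act g x = x.

(* Main.v *)
Require Import Defs.
From mathcomp Require Import all_boot all_order all_algebra.
From mathcomp Require Import all_classical all_reals all_analysis.
From mathcomp Require Import lra.

(* Let [d] be a bounded metric on [M] and [End] the equivariant continuous maps
   [M -> M]. As [M] is universal, an idempotent argument gives that [End] is a
   group and that every orbit closure in [M * M] contains the graph of one of
   its elements.
   Call [F : M -> R] slow when [F z - F (u z)] is at most the displacement
   [sup_w d (u w, w)], for [u] in [G]. The functions [g |-> F (g z)] then live in
   a compact flow, and universality of [M] yields a continuous function whose
   graph lies in the closure of the graph of [F]. The functions [d (x, h z)], for
   [h] in [End], are slow uniformly in [h]; were [End] not equicontinuous, a
   supremum of such functions would be slow and oscillate along a convergent
   sequence, which no continuous selection of its graph closure can do.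
   Hence [z |-> inf_h d (x, h z)] is continuous and [End]-invariant. The factor
   of [M] it generates is proximal, so by strong amenability it is trivial and
   the [End]-orbits are dense. An equicontinuous group commuting with [G] and
   with dense orbits makes [M] equicontinuous under [G], so [M] is a point. *)

Set Implicit Arguments.
Unset Strict Implicit.
Unset Printing Implicit Defensive.

Import Order.TTheory GRing.Theory Num.Theory.
Import numFieldNormedType.Exports.
Import ArrowAsProduct.
Local Open Scope classical_set_scope.
Local Open Scope ring_scope.

(** * Topological preliminaries *)

Lemma continuous_arrow (S I : Type) (F : set_system S) (T : topologicalType)
    (f : S -> I -> T) (l : I -> T) : Filter F ->
  (forall i, f ^~ i @ F --> l i) -> f @ F --> l.
Proof.
move=> FF fl; apply/cvg_sup => i U [V] [[W] oW <-] WfN WU.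
apply: (filterS WU); apply: (fl i W); exact: open_nbhs_nbhs.
Qed.

Lemma arrow_eval_continuous (I : Type) (T : topologicalType) (i : I) :
  continuous (fun f : I -> T => f i).
Proof. exact: (@proj_continuous {classic I} (fun=> T) i). Qed.

Lemma set_val_continuous (T : topologicalType) (A : set T) :
  continuous (set_val : A -> T).
Proof. exact: initial_continuous. Qed.

Lemma continuous_set_type (S T : topologicalType) (A : set T) (f : S -> A) :
  continuous (set_val \o f : S -> T) -> continuous f.
Proof.
move=> cf x U [_ [[V oV <-] Vx] VU].
apply: (filterS VU); apply: (cf x V); exact: open_nbhs_nbhs.
Qed.

Lemma set_type_compact (T : topologicalType) (A : set T) :
  compact A -> compact [set: A].
Proof.
move=> cA F PF _.
have FA : (set_val @ F) A.
  by apply: (@filterS _ F _ setT) => [x _|]; [exact: set_valP|exact: filterT].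
have [x [Ax clx]] := cA _ (fmap_proper_filter _ PF) FA.
exists (SigSub (mem_set Ax)); split=> // U V FU [_ [[W oW <-] Wx] WV].
have [] := clx (set_val @` U) W; first exact: (filterS (@preimage_image _ _ _ _)).
  exact: open_nbhs_nbhs.
by move=> _ [[y Uy <-] Wy]; exists y; split=> //; exact: WV.
Qed.

Lemma set_type_hausdorff (T : topologicalType) (A : set T) :
  hausdorff_space T -> hausdorff_space A.
Proof.
move=> hT x y clxy; apply: val_inj; apply: hT => U V Ux Vy.
have [z [Uz Vz]] := clxy _ _ (set_val_continuous Ux) (set_val_continuous Vy).
by exists (set_val z).
Qed.

Lemma chain_bigcap_nonempty (T : topologicalType) (C : set (set T)) :
  compact [set: T] -> C !=set0 ->
  (forall A, C A -> closed A /\ A !=set0) -> total_on C subset ->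
  \bigcap_(A in C) A !=set0.
Proof.
move=> cT [A0 CA0] hC tC.
have FF : ProperFilter (filter_from C id).
  apply: filter_from_proper => [|A /hC[]//].
  apply: filter_from_filter; first by exists A0.
  move=> A B CA CB; have [AB|BA] := tC _ _ CA CB.
    by exists A => // x Ax; split=> //; exact: AB.
  by exists B => // x Bx; split=> //; exact: BA.
have [x [_ clx]] := cT _ FF filterT.
exists x => A CA; have [clA _] := hC _ CA.
by apply: clA => B Bx; apply: clx => //; exists A.
Qed.

(** Zorn's lemma downwards, from its union form by taking complements; compactness keeps the
    intersection of a chain nonempty. It serves for subflows and for subsemigroups. *)
Lemma minimal_closed (T : topologicalType) (P : set T -> Prop) :
  compact [set: T] -> [set: T] !=set0 ->
  (forall C : set (set T), C `<=` P -> P (\bigcap_(A in C) A)) ->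
  exists A, [/\ closed A, A !=set0, P A &
    forall B, closed B -> B !=set0 -> P B -> B `<=` A -> B = A].
Proof.
move=> cT nT PI.
pose Q := [set B : set T | [/\ closed (~` B), ~` B !=set0 & P (~` B)]].
have [|B [[clB nB PB] mB]] := @Zorn_bigcup T Q.
  move=> F FQ tF; rewrite /Q /= setC_bigcup.
  have E : \bigcap_(X in F) ~` X = \bigcap_(X in setC @` F) X.
    by rewrite bigcap_image.
  split.
  - by apply: closed_bigI => i /FQ[].
  (* The empty chain intersects to the whole space, which is nonempty by assumption. *)
  - have [->|/set0P F0] := eqVneq F set0; first by rewrite bigcap_set0.
    rewrite E; apply: chain_bigcap_nonempty => //.
    + by case: F0 => X FX; exists (~` X), X.
    + by move=> _ [X /FQ[? ? ?] <-].
    + by move=> _ _ [X FX <-] [Y FY <-]; have [XY|YX] := tF _ _ FX FY;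
        [right|left]; exact: subsetC.
  - by rewrite E; apply: PI => _ [X /FQ[? ? ?] <-].
exists (~` B); split=> // D clD nD PD DB.
apply/seteqP; split=> //; apply: contrapT => BD.
apply: (mB (~` D)); last by split; rewrite setCK.
split; first by rewrite -(setCK B); exact: subsetC.
by move=> DB'; apply: BD; rewrite -(setCK D); exact: subsetC.
Qed.

(** * Subflows and universality *)

Definition equivariant (G : topologicalGroupType) (X : flow G) (T : Type)
  (act : G -> T -> T) (f : X -> T) :=
  forall g x, f (flow_act g x) = act g (f x).

(** Joint continuity is asked on [A] only: translation of functions on [G] is jointly continuous on
    slow functions, but not in general on all of [G -> R]. *)
Record flow_subset (G : topologicalGroupType) (T : topologicalType)
    (act : G -> T -> T) (A : set T) : Prop := FlowSubset {
  fs_act1 : forall x, act 1%g x = x ;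
  fs_actM : forall g h x, act (g * h)%g x = act g (act h x) ;
  fs_stable : forall g x, A x -> A (act g x) ;
  fs_continuous : continuous (fun p : G * A => act p.1 (set_val p.2)) ;
  fs_nonempty : A !=set0 ;
  fs_compact : compact A ;
  fs_hausdorff : hausdorff_space T
}.

Section Subflow.
Context (G : topologicalGroupType) (T : topologicalType) (act : G -> T -> T).
Context (A : set T) (hA : flow_subset act A).

Definition subflow_act (g : G) (x : A) : A :=
  SigSub (mem_set (fs_stable hA g (set_valP x))).

Lemma subflow_act1 x : subflow_act 1%g x = x.
Proof. by apply: val_inj => /=; rewrite (fs_act1 hA). Qed.

Lemma subflow_actM g h x :
  subflow_act (g * h)%g x = subflow_act g (subflow_act h x).
Proof. by apply: val_inj => /=; rewrite (fs_actM hA). Qed.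

Lemma subflow_act_continuous :
  continuous (fun p : G * A => subflow_act p.1 p.2).
Proof. by apply: continuous_set_type; exact: fs_continuous hA. Qed.

Lemma subflow_nonempty : [set: A] !=set0.
Proof. by have [x Ax] := fs_nonempty hA; exists (SigSub (mem_set Ax)). Qed.

Definition subflow : flow G := Flow subflow_act1 subflow_actM
  subflow_act_continuous subflow_nonempty (set_type_compact (fs_compact hA))
  (set_type_hausdorff (fs_hausdorff hA)).

End Subflow.

Section FlowTheory.
Context (G : topologicalGroupType).
Implicit Types X Y : flow G.

Lemma flow_act_continuous1 X (g : G) : continuous (@flow_act G X g).
Proof.
move=> x; apply: (@continuous_comp X (G * X)%type X (fun y => (g, y))
  (fun p => flow_act p.1 p.2)); last exact: flow_act_continuous.
by apply: cvg_pair => //; exact: cvg_cst.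
Qed.

Lemma flow_actVK X (g : G) (x : X) : flow_act g (flow_act g^-1%g x) = x.
Proof. by rewrite -flow_actM mulgV flow_act1. Qed.

Lemma flow_subset_closed X (A : set X) : closed A -> A !=set0 ->
  (forall g x, A x -> A (flow_act g x)) -> flow_subset (@flow_act G X) A.
Proof.
move=> clA nA sA; split => //.
- exact: flow_act1.
- exact: flow_actM.
- move=> [g x]; apply: (@continuous_comp _ (G * X)%type X
    (fun p : G * A => (p.1, set_val p.2)) (fun p => flow_act p.1 p.2));
    last exact: flow_act_continuous.
  apply: cvg_pair => /=; first exact: cvg_fst.
  by apply: cvg_comp; [exact: cvg_snd|exact: set_val_continuous].
- exact: (subclosed_compact clA (@flow_compact G X)).
- exact: flow_hausdorff.
Qed.

Lemma minimal_closed_stable X (A : set X) : minimal X -> closed A ->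
  A !=set0 -> (forall g x, A x -> A (flow_act g x)) -> A = setT.
Proof.
move=> mX clA [x Ax] sA; apply/seteqP; split=> // y _.
apply: clA => U Uy; rewrite nbhsE in Uy.
have [V [oV Vy] VU] := Uy.
have [z [Vz [g _ gz]]] := mX x V (ex_intro _ y Vy) oV.
by exists z; split; [rewrite -gz; exact: sA|exact: VU].
Qed.

Lemma closure_orbit_stable (T : topologicalType) (act : G -> T -> T) (x : T) :
  (forall g h y, act (g * h)%g y = act g (act h y)) ->
  (forall g, continuous (act g)) ->
  forall g y, closure (range (act^~ x)) y -> closure (range (act^~ x)) (act g y).
Proof.
move=> actM cact g y cly U Ugy; have [_ [[h _ <-] Uz]] := cly _ (cact g _ _ Ugy).
by exists (act g (act h x)); split=> //; exists (g * h)%g => //; rewrite actM.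
Qed.

Lemma stable_closed_minimal X :
  (forall B : set X, closed B -> B !=set0 ->
    (forall g x, B x -> B (flow_act g x)) -> B = setT) -> minimal X.
Proof.
move=> mB x U [y Uy] oU.
have cl : closure (range (fun g => flow_act g x)) = setT.
  apply: mB; first exact: closed_closure.
    by exists x; apply: subset_closure; exists 1%g => //; rewrite flow_act1.
  by apply: closure_orbit_stable; [exact: flow_actM|exact: flow_act_continuous1].
have : closure (range (fun g => flow_act g x)) y by rewrite cl.
move=> /(_ U (open_nbhs_nbhs (conj oU Uy))) [z [? ?]].
by exists z.
Qed.

Lemma minimal_subflow X : exists Y (f : Y -> X),
  [/\ minimal Y, continuous f & equivariant (@flow_act G X) f].
Proof.
have [||C CP|A [clA nA sA mA]] := @minimal_closed X
    (fun A => forall g x, A x -> A (flow_act g x)).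
- exact: flow_compact.
- exact: flow_nonempty.
- by move=> g x Cx A CA; apply: CP => //; exact: Cx.
exists (subflow (flow_subset_closed clA nA sA)), set_val; split => //; last first.
  exact: set_val_continuous.
apply: stable_closed_minimal => B clB [x Bx] sB.
have cB : closed (set_val @` B : set X).
  apply: compact_closed; first exact: flow_hausdorff.
  apply: continuous_compact.
    by apply: continuous_subspaceT; exact: set_val_continuous.
  by apply: (subclosed_compact clB (set_type_compact _)) => //;
    exact: (subclosed_compact clA (@flow_compact G X)).
have BA : set_val @` B = A.
  apply: mA => //; first by exists (set_val x), x.
    by move=> g _ [y By <-]; 
      exists (subflow_act (flow_subset_closed clA nA sA) g y) => //; exact: sB.
  by move=> _ [y _ <-]; exact: set_valP.
apply/seteqP; split=> // y _.
have := set_valP y; rewrite -{1}BA => -[z Bz zy].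
by rewrite -(val_inj zy).
Qed.

(** Map [M] onto a minimal subflow of [A] and include it in [T]; surjectivity onto [A] is lost. The
    existence results below come from well-chosen sets [A]. *)
Lemma universal_map (M : flow G) (T : topologicalType) (act : G -> T -> T)
    (A : set T) : universal_minimal_flow M -> flow_subset act A ->
  exists f : M -> T,
    [/\ continuous f, equivariant act f & forall x, A (f x)].
Proof.
move=> [_ uM] hA; have [Y [f [mY cf ef]]] := minimal_subflow (subflow hA).
have [h [ch eh _]] := uM _ mY.
exists (fun m => set_val (f (h m) : A)); split.
- move=> x; apply: (@continuous_comp M A T (f \o h) set_val).
    by apply: continuous_comp; [exact: ch|exact: cf].
  exact: set_val_continuous.
- by move=> g x /=; rewrite eh ef.
- by move=> x; exact: set_valP.
Qed.

End FlowTheory.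

(** * Endomorphisms of the universal minimal flow *)

Lemma closed_equalizer (S T : topologicalType) (f g : S -> T) :
  hausdorff_space T -> continuous f -> continuous g ->
  closed [set x | f x = g x].
Proof.
move=> hT cf cg x clx; apply: hT => U V Ufx Vgx.
have [y [/= fgy [Uy Vy]]] :
    [set y | f y = g y] `&` (f @^-1` U `&` g @^-1` V) !=set0.
  by apply: clx; apply: filterI; [exact: cf|exact: cg].
by exists (f y); split=> //; rewrite fgy.
Qed.

Lemma hausdorff_pair (S T : topologicalType) :
  hausdorff_space S -> hausdorff_space T -> hausdorff_space (S * T)%type.
Proof.
move=> hS hT [x1 x2] [y1 y2] cl.
have -> : x1 = y1.
  apply: hS => U V Ux Vy.
  have [||[z1 z2] [/= [? _] [? _]]] := cl (U `*` setT) (V `*` setT).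
  - by exists (U, setT) => //; split=> //; exact: filterT.
  - by exists (V, setT) => //; split=> //; exact: filterT.
  - by exists z1.
congr pair; apply: hT => U V Ux Vy.
have [||[z1 z2] [/= [_ ?] [_ ?]]] := cl (setT `*` U) (setT `*` V).
- by exists (setT, U) => //; split=> //; exact: filterT.
- by exists (setT, V) => //; split=> //; exact: filterT.
- by exists z2.
Qed.

Lemma pair_map_continuous (S S' U U' : topologicalType) (f : S -> S')
    (g : U -> U') : continuous f -> continuous g ->
  continuous (fun p : S * U => (f p.1, g p.2)).
Proof.
move=> cf cg p; apply: cvg_pair.
  by apply: (@cvg_comp _ _ _ fst f); [exact: cvg_fst|exact: cf].
by apply: (@cvg_comp _ _ _ snd g); [exact: cvg_snd|exact: cg].
Qed.

Lemma flow_subset_prod (G : topologicalGroupType) (X : flow G)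
    (U : topologicalType) (act : G -> U -> U) (K : set U) (A : set (X * U)) :
  flow_subset act K -> closed A -> A !=set0 -> A `<=` setT `*` K ->
  (forall g p, A p -> A (flow_act g p.1, act g p.2)) ->
  flow_subset (fun g (p : X * U) => (flow_act g p.1, act g p.2)) A.
Proof.
move=> hK clA nA AK sA; split=> //.
- by move=> [x y] /=; rewrite flow_act1 (fs_act1 hK).
- by move=> g h [x y] /=; rewrite flow_actM (fs_actM hK).
- have cval : continuous (fun q : G * A => set_val q.2 : X * U).
    move=> q; apply: (@cvg_comp _ _ _ snd set_val); first exact: cvg_snd.
    exact: set_val_continuous.
  move=> q; apply: cvg_pair.
    apply: (@continuous_comp _ (G * X)%type X
      (fun q : G * A => (q.1, (set_val q.2).1)) (fun p => flow_act p.1 p.2));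
      last exact: flow_act_continuous.
    apply: cvg_pair => /=; first exact: cvg_fst.
    by apply: (@cvg_comp _ _ _ _ fst); [exact: cval|exact: cvg_fst].
  (* Joint continuity of [act] is known on [K] only, so second coordinates are first viewed as
     points of [K]. *)
  have K2 (p : G * A) : K (set_val p.2).2 by have [] := AK _ (set_valP p.2).
  apply: (@continuous_comp _ (G * K)%type U
    (fun q : G * A => (q.1, SigSub (mem_set (K2 q)) : K))
    (fun p => act p.1 (set_val p.2))); last exact: (fs_continuous hK).
  have cK2 : continuous (fun q : G * A => SigSub (mem_set (K2 q)) : K).
    apply: continuous_set_type => p.
    apply: (@continuous_comp _ (X * U)%type U (fun q => set_val q.2) snd).
      exact: cval.
    exact: cvg_snd.
  exact: cvg_pair (cvg_fst : fst @ q --> q.1) (cK2 q).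
- apply: (subclosed_compact clA (compact_setX (@flow_compact G X) (fs_compact hK))).
  exact: AK.
- exact: hausdorff_pair (@flow_hausdorff G X) (fs_hausdorff hK).
Qed.

Lemma compact_inverse_continuous (S T : topologicalType) (f : S -> T)
    (k : T -> S) : compact [set: S] -> hausdorff_space T -> continuous f ->
  cancel f k -> cancel k f -> continuous k.
Proof.
move=> cS hT cf fK kK; apply/continuous_closedP => B clB.
have -> : k @^-1` B = f @` B.
  by apply/seteqP; split=> [y By|_ [x Bx <-]]; [exists (k y)|rewrite /= fK].
apply: compact_closed hT _; apply: continuous_compact.
  exact: continuous_subspaceT.
exact: (subclosed_compact clB cS).
Qed.

Definition endo (G : topologicalGroupType) (M : flow G) (h : M -> M) :=
  continuous h /\ equivariant (@flow_act G M) h.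

Section Coalescence.
Context (G : topologicalGroupType) (M : flow G) (hM : universal_minimal_flow M).
Implicit Types (h k : M -> M).

Lemma endo_id : endo (id : M -> M).
Proof. by split=> [x|]; [exact: cvg_id|]. Qed.

Lemma endo_comp h k : endo h -> endo k -> endo (h \o k).
Proof.
move=> [ch eh] [ck ek]; split=> [x|g x /=]; last by rewrite ek eh.
by apply: continuous_comp; [exact: ck|exact: ch].
Qed.

(** The image is compact, hence closed, and invariant, so minimality makes it everything. *)
Lemma endo_surjective h : endo h -> forall y, exists x, h x = y.
Proof.
move=> [ch eh] y; suff : range h y by move=> [x _]; exists x.
have [mM _] := hM; rewrite (minimal_closed_stable mM (A := range h)) //.
- apply: compact_closed; first exact: flow_hausdorff.
  by apply: continuous_compact (@flow_compact G M); exact: continuous_subspaceT.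
- by have [x _] := @flow_nonempty G M; exists (h x), x.
- by move=> g _ [x _ <-]; exists (flow_act g x).
Qed.

Lemma flow_subset_arrow (A : set (M -> M)) : closed A -> A !=set0 ->
  (forall g p, A p -> A (fun m => flow_act g (p m))) ->
  flow_subset (fun g (p : M -> M) m => flow_act g (p m)) A.
Proof.
move=> clA nA sA; split=> //.
- by move=> p; apply/funext => m; rewrite flow_act1.
- by move=> g h p; apply/funext => m; rewrite flow_actM.
- move=> [g p]; apply: continuous_arrow => m.
  apply: (@continuous_comp _ (G * M)%type M
    (fun q : G * A => (q.1, set_val q.2 m)) (fun p => flow_act p.1 p.2));
    last exact: flow_act_continuous.
  apply: cvg_pair => /=; first exact: cvg_fst.
  apply: (@cvg_comp _ _ _ snd (fun q : A => set_val q m)); first exact: cvg_snd.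
  apply: (@cvg_comp _ _ _ set_val (fun q : M -> M => q m)).
    exact: set_val_continuous.
  exact: arrow_eval_continuous.
- have cT : compact [set p : M -> M | forall m, setT (p m)].
    exact: (@tychonoff {classic M} (fun=> M) (fun=> setT)
      (fun=> @flow_compact G M)).
  by apply: (subclosed_compact clA cT).
- exact: (@hausdorff_product {classic M} (fun=> M) (fun=> @flow_hausdorff G M)).
Qed.

(** Let [A] be the self-maps of [M] commuting with every endomorphism, a closed invariant set
    containing [id]. An equivariant map from [M] to [A] is a product on [M]; since [mul^~ z] is
    itself an endomorphism, commuting with it is associativity. *)
Lemma right_topological_product : exists mul : M -> M -> M,
  [/\ forall y, endo (mul^~ y),
      associative mul
    & forall h x y, endo h -> mul x (h y) = h (mul x y)].
Proof.
pose A := [set p : M -> M | forall h, endo h -> forall m, p (h m) = h (p m)].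
have hA : flow_subset (fun g (p : M -> M) m => flow_act g (p m)) A.
  apply: flow_subset_arrow.
  - have -> : A = \bigcap_(hm in [set hm : (M -> M) * M | endo hm.1])
        [set p | p (hm.1 hm.2) = hm.1 (p hm.2)].
      apply/seteqP; split=> [p Ap [h m] /= eh|p Ap h eh m]; first exact: Ap.
      exact: (Ap (h, m)).
    apply: closed_bigI => -[h m] /= [ch _].
    apply: closed_equalizer; first exact: flow_hausdorff.
      exact: arrow_eval_continuous.
    move=> p; apply: continuous_comp; last exact: ch.
    exact: arrow_eval_continuous.
  - by exists id.
  - by move=> g p Ap h eh m; rewrite Ap // eh.2.
have [mul [cmul emul Amul]] := universal_map hM hA.
have endo_mul y : endo (mul^~ y).
  split=> [x|g x]; last by rewrite emul.
  apply: (@continuous_comp _ _ _ mul (fun p : M -> M => p y)); first exact: cmul.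
  exact: arrow_eval_continuous.
exists mul; split=> // [x y z|h x y eh]; last exact: Amul.
by rewrite (Amul x _ (endo_mul z)).
Qed.

(** The Ellis-Numakura argument: for [x] in a minimal closed subsemigroup [A], both [A x] and the
    solutions in [A] of [y x = x] are closed subsemigroups, hence equal to [A]. *)
Lemma idempotent_exists (mul : M -> M -> M) :
  (forall y, continuous (mul^~ y)) -> associative mul ->
  exists u, mul u u = u.
Proof.
move=> cmul mulA.
have [||C CP|A [clA [x Ax] AA mA]] := @minimal_closed M
    (fun A => forall x y, A x -> A y -> A (mul x y)).
- exact: flow_compact.
- exact: flow_nonempty.
- by move=> x y Cx Cy A CA; apply: CP => //; [exact: Cx|exact: Cy].
have cA := subclosed_compact clA (@flow_compact G M) (@subsetT _ _).
have Ax_eq : mul^~ x @` A = A.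
  apply: mA.
  - apply: compact_closed; first exact: flow_hausdorff.
    by apply: continuous_compact cA; exact: continuous_subspaceT.
  - by exists (mul x x), x.
  - by move=> _ _ [y Ay <-] [z Az <-]; exists (mul (mul y x) z); rewrite ?mulA//;
      apply: (AA) => //; exact: AA.
  - by move=> _ [y Ay <-]; exact: AA.
have A1 : A `&` [set y | mul y x = x] = A.
  apply: mA => //.
  - apply: closedI => //; apply: closed_equalizer => //.
      exact: flow_hausdorff.
    by move=> y; exact: cvg_cst.
  - by move: Ax; rewrite -{1}Ax_eq => -[y Ay yx]; exists y.
  - move=> y z [Ay yx] [Az zx]; split; first exact: AA.
    by rewrite /= -mulA zx.
by exists x; move: Ax; rewrite -{1}A1 => -[].
Qed.

(** An idempotent [u] is a right identity, because [mul^~ u] is onto. Hence [h] is right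
    multiplication by [h u], and a left inverse [s] of [h u] turns out to undo it. *)
Lemma endo_injective h : endo h -> injective h.
Proof.
move=> eh; have [mul [emul mulA mulh]] := right_topological_product.
have [u uu] := idempotent_exists (fun y => (emul y).1) mulA.
have mulu x : mul x u = x.
  by have [y <-] := endo_surjective (emul u) x; rewrite -mulA uu.
have [s sr] := endo_surjective (emul (h u)) u.
have [t ts] := endo_surjective (emul s) u.
have ur : mul u (h u) = t by rewrite -{1}ts -mulA sr mulu.
have hmul x : mul (h x) s = x.
  (* In product notation, [h x = x (h u) = x u (h u) = x t], and [x t s = x u = x]. *)
  by rewrite -{1}(mulu x) -mulh // -{1}(mulu x) -(mulA x) ur -mulA ts mulu.
by move=> x y hxy; rewrite -(hmul x) hxy hmul.
Qed.

Lemma endo_inverse h : endo h ->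
  exists k, [/\ endo k, cancel h k & cancel k h].
Proof.
move=> eh; have [k kK] := choice (endo_surjective eh).
have hK : cancel h k by move=> x; apply: (endo_injective eh); rewrite kK.
exists k; split=> //; split.
  by apply: compact_inverse_continuous hK kK;
    [exact: flow_compact|exact: flow_hausdorff|exact: eh.1].
by move=> g x; apply: (endo_injective eh); rewrite eh.2 !kK.
Qed.

(** Map [M] into the orbit closure of [(a, b)]. The first coordinate is an invertible endomorphism;
    precomposing with its inverse turns the map into the graph of an endomorphism. *)
Lemma closure_orbit_endo (a b : M) : exists m h,
  endo h /\ closure (range (fun g => (flow_act g a, flow_act g b))) (m, h m).
Proof.
pose act (g : G) (p : M * M) := (flow_act g p.1, flow_act g p.2).
have cact g : continuous (act g).
  by apply: pair_map_continuous; exact: flow_act_continuous1.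
have hA : flow_subset act (closure (range (act^~ (a, b)))).
  apply: flow_subset_prod => //.
  - by apply: flow_subset_closed; [exact: closedT|exact: flow_nonempty|].
  - exact: closed_closure.
  - by exists (act 1%g (a, b)); apply: subset_closure; exists 1%g.
  - by move=> p _; split.
  - apply: (closure_orbit_stable (act := act)) => // g h p.
    by rewrite /act !flow_actM.
have [f [cf ef Af]] := universal_map hM hA.
have [k [ek k1 k2]] : exists k, [/\ endo k, cancel (fst \o f) k &
    cancel k (fst \o f)].
  apply: endo_inverse; split=> [x|g x]; last by rewrite /= ef.
  by apply: (@cvg_comp _ _ _ f fst); [exact: cf|exact: cvg_fst].
have [m _] := @flow_nonempty G M.
exists m, (snd \o f \o k); split; last first.
  by have := Af (k m); rewrite [f (k m)]surjective_pairing [(f (k m)).1]k2.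
apply: (@endo_comp (snd \o f)) => //; split=> [x|g x]; last by rewrite /= ef.
by apply: (@cvg_comp _ _ _ f snd); [exact: cf|exact: cvg_snd].
Qed.

End Coalescence.

(** * Slow functions *)

(** A function on the points of [T] themselves, not a structure on a homeomorphic copy. The bound 1
    keeps distances in the interval where slow functions take their values. *)
Record bounded_metric (R : realType) (T : topologicalType) (d : T -> T -> R)
    : Prop := BoundedMetric {
  bm_ge0 : forall x y, 0 <= d x y ;
  bm_le1 : forall x y, d x y <= 1 ;
  bm_xx : forall x, d x x = 0 ;
  bm_sym : forall x y, d x y = d y x ;
  bm_triangle : forall y x z, d x z <= d x y + d y z ;
  bm_nbhs : forall x V, nbhs x V <-> exists2 e, 0 < e & forall y, d x y < e -> V y
}.

Lemma metrizable_bounded (R : realType) (T : topologicalType) :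
  metrizable R T -> exists d : T -> T -> R, bounded_metric d.
Proof.
move=> [N [f [k [cf ck fK kK]]]].
exists (fun x y => Num.min 1 (mdist (f x) (f y))); split.
- by move=> x y; rewrite le_min ler01 mdist_ge0.
- by move=> x y; rewrite ge_min lexx.
- by move=> x; rewrite mdistxx; apply/min_idPr; exact: ler01.
- by move=> x y; rewrite metric_sym.
- move=> y x z; have := metric_triangle (f x) (f y) (f z).
  have := mdist_ge0 (f x) (f y); have := mdist_ge0 (f y) (f z).
  rewrite !minEle; case: ifP; case: ifP; case: ifP; lra.
- move=> x V; split=> [xV|[e e0 eV]].
    have : nbhs (f x) (k @^-1` V) by apply: ck; rewrite fK.
    rewrite -nbhs_ballE => -[e /= e0 eV]; exists (Num.min 1 e).
      by rewrite lt_min ltr01.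
    move=> y; rewrite lt_min !gt_min ltxx /= => /andP[ylt1 /orP[y1|ye]].
      by rewrite -(fK y); apply: eV; rewrite ballEmdist /= (lt_trans ylt1).
    by rewrite -(fK y); apply: eV; rewrite ballEmdist.
  have : nbhs x (f @^-1` ball (f x) e).
    by apply: cf; exact: nbhsx_ballx.
  apply: filterS => y; rewrite /= ballEmdist /= => yxe; apply: eV.
  by rewrite gt_min yxe orbT.
Qed.

Lemma closed_le_fun (R : realType) (S : topologicalType) (f g : S -> R) :
  continuous f -> continuous g -> closed [set x | f x <= g x].
Proof.
move=> cf cg.
have -> : [set x | f x <= g x] = (fun x => g x - f x) @^-1` [set y | 0 <= y].
  by apply/seteqP; split=> x /=; rewrite subr_ge0.
have /continuous_closedP : continuous (fun x => g x - f x).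
  by move=> x; apply: cvgB; [exact: cg|exact: cf].
by apply; exact: closed_ge.
Qed.

Section Slow.
Context (G : topologicalGroupType) (M : flow G) (R : realType).
Context (d : M -> M -> R) (hd : bounded_metric d).

Definition displacement_le (u : G) (c : R) :=
  forall w : M, d (flow_act u w) w <= c.

Lemma displacement_leV u c : displacement_le u c -> displacement_le u^-1%g c.
Proof.
move=> uc w; rewrite (bm_sym hd).
by have := uc (flow_act u^-1%g w); rewrite flow_actVK.
Qed.

Lemma displacement_ge0 u c : displacement_le u c -> 0 <= c.
Proof.
have [w _] := @flow_nonempty G M.
by move=> /(_ w); apply: le_trans; exact: bm_ge0 hd _ _.
Qed.

(** Compactness of [M] makes the continuity of the action at [1] uniform over [M]. *)
Lemma displacement_near e : 0 < e ->
  \forall u \near (1%g : G), displacement_le u e.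
Proof.
move=> e0.
have := (compact_near_coveringP _).1 (@flow_compact G M) G (nbhs 1%g)
  (fun u w => d (flow_act u w) w <= e) _.
move=> cover; suff : \forall u \near (1%g : G),
    [set: M] `<=` (fun w => d (flow_act u w) w <= e).
  by apply: filterS => u Hu w; exact: Hu.
apply: cover.
move=> w _.
have Bw : nbhs w [set y | d w y < e / 2].
  by apply/(bm_nbhs hd); exists (e / 2) => //; rewrite divr_gt0.
have := @flow_act_continuous G M (1%g, w); rewrite /continuous_at /= flow_act1.
move=> /(_ _ Bw) [[U V] /= [U1 Vw] UV].
exists (V `&` [set y | d w y < e / 2], U) => /=.
  by split=> //; exact: filterI.
move=> [y u] /= [[Vy wy] Uu]; have := UV (u, y) (conj Uu Vy); rewrite /= => wuy.
have := bm_triangle hd w (flow_act u y) y; rewrite (bm_sym hd (flow_act u y) w).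
lra.
Qed.

(** One inequality suffices, as [u^-1] obeys the same displacement bounds as [u]. All slow functions
    thus share one modulus of uniform continuity. *)
Definition slow (phi : G -> R) :=
  forall u c, displacement_le u c -> forall h, phi h <= phi (u * h)%g + c.

Definition slow_set : set (G -> R) :=
  [set phi | slow phi /\ forall h, 0 <= phi h <= 1].

(** With this side, [rtrans g] takes the orbit function of a point [z] to that of [flow_act g z]. *)
Definition rtrans (g : G) (phi : G -> R) : G -> R := fun h => phi (h * g)%g.

Lemma rtrans1 phi : rtrans 1%g phi = phi.
Proof. by apply/funext => h; rewrite /rtrans mulg1. Qed.

Lemma rtransM g h phi : rtrans (g * h)%g phi = rtrans g (rtrans h phi).
Proof. by apply/funext => k; rewrite /rtrans mulgA. Qed.

Lemma slow_set_rtrans g phi : slow_set phi -> slow_set (rtrans g phi).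
Proof.
by move=> [sphi bphi]; split=> [u c uc h|h]; rewrite /rtrans // -mulgA; exact: sphi.
Qed.

Lemma slow_set_closed : closed slow_set.
Proof.
have -> : slow_set =
    (\bigcap_(p in [set p : G * R * G | displacement_le p.1.1 p.1.2])
      [set phi : G -> R | phi p.2 <= phi (p.1.1 * p.2)%g + p.1.2]) `&`
    \bigcap_h ([set phi : G -> R | 0 <= phi h] `&` [set phi : G -> R | phi h <= 1]).
  apply/seteqP; split=> [phi [s b]|phi [s b]].
    by split=> [[[u c] h] /= uc|h _]; [exact: s|have /andP[] := b h].
  by split=> [u c uc h|h]; [exact: (s (u, c, h))|have [/= -> ->] := b h Logic.I].
apply: closedI; first (apply: closed_bigI => -[[u c] h] _).
  apply: closed_le_fun; first exact: arrow_eval_continuous.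
  move=> phi; apply: (@cvgD _ _ _ (nbhs phi) _ (fun f : G -> R => f (u * h)%g)
    (fun=> c)); [exact: arrow_eval_continuous|exact: cvg_cst].
apply: closed_bigI => h _.
have ev := @arrow_eval_continuous G R h.
have cst (c : R) : continuous (fun _ : G -> R => c).
  exact: cst_continuous.
by apply: closedI; apply: closed_le_fun.
Qed.

Lemma slow_set_compact : compact slow_set.
Proof.
have cT := @tychonoff {classic G} (fun=> R) (fun=> `[0, 1]%classic)
  (fun=> @segment_compact R 0 1).
apply: (subclosed_compact slow_set_closed cT) => phi [_ b] h /=.
by rewrite in_itv /=; exact: b.
Qed.

Lemma rtrans_continuous (S : topologicalType) (a : S -> G) (phi : S -> G -> R) :
  continuous a -> continuous phi -> (forall s, slow_set (phi s)) ->
  continuous (fun s => rtrans (a s) (phi s)).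
Proof.
move=> ca cphi sphi s0; apply: continuous_arrow => h.
apply/cvgrPdist_lt => e e0; rewrite /rtrans.
(* Moving the argument from [h * a s0] to [h * a s] is left multiplication by [u s], which tends to
   [1], so slowness bounds its cost uniformly in the function. *)
pose u s := ((h * a s) * (h * a s0)^-1)%g.
have cu : u @ s0 --> (1%g : G).
  have -> : 1%g = u s0 by rewrite /u mulgV.
  have cmul (b c : S -> G) : b @ s0 --> b s0 -> c @ s0 --> c s0 ->
      (fun s => (b s * c s)%g) @ s0 --> (b s0 * c s0)%g.
    move=> cb cc; apply: (@continuous_comp _ (G * G)%type G
      (fun s => (b s, c s)) (fun p => (p.1 * p.2)%g)); first exact: cvg_pair.
    exact: mulg_continuous.
  apply: (cmul _ (fun=> _)); last exact: cvg_cst.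
  by apply: (cmul (fun=> _)); [exact: cvg_cst|exact: ca].
have e3 : 0 < e / 3 by rewrite divr_gt0.
have n1 : \forall s \near s0, displacement_le (u s) (e / 3).
  exact: cu (displacement_near e3).
have n2 : \forall s \near s0,
    `|phi s0 (h * a s0)%g - phi s (h * a s0)%g| < e / 3.
  have : (fun s => phi s (h * a s0)%g) @ s0 --> phi s0 (h * a s0)%g.
    apply: (@continuous_comp _ _ _ phi (fun p : G -> R => p (h * a s0)%g)).
      exact: cphi.
    exact: arrow_eval_continuous.
  by move=> /cvgrPdist_lt; exact.
move: n1 n2; apply: filterS2 => s us; rewrite !ltr_norml => /andP[? ?].
have E : (h * a s)%g = (u s * (h * a s0))%g by rewrite /u mulgVK.
have := (sphi s).1 _ _ us (h * a s0)%g; rewrite -E.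
have := (sphi s).1 _ _ (displacement_leV us) (h * a s)%g.
by rewrite {2}E mulKg => ? ?; apply/andP; split; lra.
Qed.

Lemma flow_subset_slow (A : set (G -> R)) : closed A -> A !=set0 ->
  A `<=` slow_set -> (forall g phi, A phi -> A (rtrans g phi)) ->
  flow_subset rtrans A.
Proof.
move=> clA nA sA stA; split=> //.
- exact: rtrans1.
- exact: rtransM.
- apply: (@rtrans_continuous (G * A)%type fst (fun q => set_val q.2)).
  + by move=> q; exact: cvg_fst.
  + move=> q; apply: (@cvg_comp _ _ _ snd set_val); first exact: cvg_snd.
    exact: set_val_continuous.
  + by move=> q; apply: sA; exact: set_valP.
- exact: (subclosed_compact clA slow_set_compact).
- by apply: (@hausdorff_product {classic G} (fun=> R)) => ?; exact: Rhausdorff.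
Qed.

Lemma slow_orbit (F : M -> R) (z : M) : (forall z, 0 <= F z <= 1) ->
  (forall u c, displacement_le u c -> forall z, F z <= F (flow_act u z) + c) ->
  slow_set (fun g => F (flow_act g z)).
Proof.
by move=> bF sF; split=> // u c uc h; rewrite flow_actM; exact: sF.
Qed.

End Slow.

(** * Continuous selections from the graph closure of a slow function *)

Section Selection.
Context (G : topologicalGroupType) (M : flow G) (hM : universal_minimal_flow M).
Context (R : realType) (d : M -> M -> R) (hd : bounded_metric d).

Local Notation T := (M * (G -> R))%type.

(** [F] may be discontinuous. Pairs of a point and a slow function whose translates all stay over
    the graph closure form a compact flow; [M] maps into it, and the point coordinate can be
    normalized to the identity. *)
Lemma slow_selection (F : M -> R) : (forall z, 0 <= F z <= 1) ->
  (forall u c, displacement_le d u c ->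
    forall z, F z <= F (flow_act u z) + c) ->
  exists phi : M -> R, continuous phi /\
    forall z, closure [set p : M * R | p.2 = F p.1] (z, phi z).
Proof.
move=> bF sF; set C := closure _.
pose A := [set p : T | slow_set d p.2 /\ forall g, C (flow_act g p.1, p.2 g)].
have csnd : continuous (snd : T -> G -> R) by move=> p; exact: cvg_snd.
have cfst : continuous (fst : T -> M) by move=> p; exact: cvg_fst.
have clA : closed A.
  have -> : A = (snd @^-1` slow_set d) `&`
      \bigcap_g ((fun p : T => (flow_act g p.1, p.2 g)) @^-1` C).
    by apply/seteqP; split=> p [sp Cp]; split=> // g; [move=> _|]; exact: Cp.
  apply: closedI; first apply: (@preimage_closed T (G -> R) snd).
    move=> p _; exact: csnd.
    exact: slow_set_closed.
  apply: closed_bigI => g _; apply: preimage_closed (in1W _) (@closed_closure _ _).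
  apply: (pair_map_continuous (g := fun f : G -> R => f g)).
    exact: flow_act_continuous1.
  exact: arrow_eval_continuous.
have slowF z : slow_set d (fun g => F (flow_act g z)) by exact: slow_orbit.
have [z0 _] := @flow_nonempty G M.
have hA : flow_subset (fun g (p : T) => (flow_act g p.1, rtrans g p.2)) A.
  apply: (flow_subset_prod (K := slow_set d)) => //.
  - apply: (flow_subset_slow hd) => //; first exact: slow_set_closed.
      by exists (fun g => F (flow_act g z0)).
    exact: slow_set_rtrans.
  - exists (z0, fun g => F (flow_act g z0)).
    by split=> [|g]; [exact: slowF|exact: subset_closure].
  - by move=> p [].
  - move=> g [z f] [/= sf Cf]; split=> /=; first exact: slow_set_rtrans.
    by move=> h; rewrite -flow_actM; exact: Cf.
have [f [cf ef Af]] := universal_map hM hA.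
have [k [[ck _] k1 k2]] : exists k, [/\ endo k, cancel (fst \o f) k &
    cancel k (fst \o f)].
  apply: (endo_inverse hM); split=> [x|g x]; last by rewrite /= ef.
  by apply: (@cvg_comp _ _ _ f fst); [exact: cf|exact: cfst].
(* The second coordinate plays the part of an orbit function of [z], so its value at [1] is the
   value at [z]. *)
exists (fun z => (f (k z)).2 1%g); split.
  move=> z; apply: (@cvg_comp _ _ _ k (fun z => (f z).2 1%g)); first exact: ck.
  apply: (@cvg_comp _ _ _ f (fun p : T => p.2 1%g)); first exact: cf.
  by apply: (@cvg_comp _ _ _ snd (fun f : G -> R => f 1%g)); [exact: csnd|
    exact: arrow_eval_continuous].
move=> z; have [_ /(_ 1%g)] := Af (k z).
by rewrite flow_act1 [(f (k z)).1]k2.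
Qed.

Lemma selection_ge (F phi : M -> R) (c : R) (z : M) :
  closure [set p : M * R | p.2 = F p.1] (z, phi z) ->
  (\forall y \near z, c <= F y) -> c <= phi z.
Proof.
move=> cl cF; rewrite leNgt; apply/negP => zc.
have [|[y r] /= [-> [cy rc]]] := cl ([set y | c <= F y] `*` [set r | r < c]).
  exists ([set y | c <= F y], [set r | r < c]) => //; split=> //=.
  by apply: open_nbhs_nbhs; split=> //; exact: open_lt.
by move: rc => /=; rewrite ltNge cy.
Qed.

Lemma selection_le (F phi : M -> R) (c : R) (z : M) :
  closure [set p : M * R | p.2 = F p.1] (z, phi z) ->
  (\forall y \near z, F y <= c) -> phi z <= c.
Proof.
move=> cl cF; rewrite leNgt; apply/negP => zc.
have [|[y r] /= [-> [cy rc]]] := cl ([set y | F y <= c] `*` [set r | c < r]).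
  exists ([set y | F y <= c], [set r | c < r]) => //; split=> //=.
  by apply: open_nbhs_nbhs; split=> //; exact: open_gt.
by move: rc => /=; rewrite ltNge cy.
Qed.
End Selection.

(** * Equicontinuity of the endomorphisms *)

Section EndoEquicontinuity.
Context (G : topologicalGroupType) (M : flow G) (hM : universal_minimal_flow M).
Context (R : realType) (d : M -> M -> R) (hd : bounded_metric d).

Lemma nbhs_bm_ball (x y : M) r : d x y < r -> nbhs y [set z | d x z < r].
Proof.
move=> xyr; apply/(bm_nbhs hd); exists (r - d x y); first by rewrite subr_gt0.
by move=> z yz /=; have := bm_triangle hd y x z; lra.
Qed.

(** As [h] commutes with [u], only the displacement of [h z] under [u] matters; the bound is uniform
    in [h]. *)
Lemma endo_displacement h u c : endo h -> displacement_le d u c ->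
  forall x z, `|d x (h z) - d x (h (flow_act u z))| <= c.
Proof.
move=> [_ eh] uc x z; rewrite eh; have := uc (h z).
have := bm_triangle hd (flow_act u (h z)) x (h z).
have := bm_triangle hd (h z) x (flow_act u (h z)).
rewrite (bm_sym hd (h z)) ler_norml => ? ? ?; apply/andP; split; lra.
Qed.

(* If equicontinuity fails at [x], witnesses [y n, h n] can be chosen so that
   [f k (y n)] is small for [k < n] and large for [k = n]; a slow function
   separating the even from the odd [y n] then contradicts [slow_selection]. *)
Lemma endo_equicontinuous (x : M) e : 0 < e -> exists2 r, 0 < r &
  forall y h, endo h -> d x y < r -> d (h x) (h y) < e.
Proof.
move=> e0; apply: contrapT => nequi.
have /choice[Y HY] : forall r, exists yh : M * (M -> M), 0 < r ->
    [/\ endo yh.2, d x yh.1 < r & e <= d (yh.2 x) (yh.2 yh.1)].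
  move=> r; have [r0|r0] := boolP (0 < r); last by exists (x, id).
  apply: contrapT => nr; apply: nequi; exists r => // y h eh xy.
  by rewrite ltNge; apply/negP => ?; apply: nr; exists (y, h).
(* [D r] is the scale after [r]: at most half of it, and so small that the map chosen at scale [r]
   barely moves points within [D r] of [x] away from the image of [x]. *)
have /choice[D HD] : forall r, exists s, 0 < r -> [/\ 0 < s, s <= r / 2 &
    forall z, d x z < s -> d ((Y r).2 x) ((Y r).2 z) < e / 4].
  move=> r; have [r0|r0] := boolP (0 < r); last by exists 0.
  have [[ch _] _ _] := HY _ r0.
  have /(bm_nbhs hd)[s s0 hs] :
      nbhs x ((Y r).2 @^-1` [set w | d ((Y r).2 x) w < e / 4]).
    by apply: ch; apply: nbhs_bm_ball; rewrite (bm_xx hd) divr_gt0.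
  exists (Num.min s (r / 2)) => _; split.
  - by rewrite lt_min s0 divr_gt0.
  - by rewrite ge_min lexx orbT.
  - by move=> z; rewrite lt_min => /andP[/hs].
pose r n := iter n D 1; pose y n := (Y (r n)).1; pose h n := (Y (r n)).2.
pose f n z := d (h n x) (h n z).
have r0 n : 0 < r n by elim: n => [|n /HD[]//]; exact: ltr01.
have rS n : r n.+1 <= r n / 2 by have [] := HD _ (r0 n).
have rmono m n : (m <= n)%N -> r n <= r m.
  elim: n => [|n IHn]; first by rewrite leqn0 => /eqP ->.
  rewrite leq_eqVlt => /orP[/eqP -> //|/IHn].
  by have := rS n; have := r0 n; lra.
have small k n z : (k < n)%N -> d x z < r n -> f k z < e / 4.
  move=> kn xz; have [_ _] := HD _ (r0 k); apply.
  exact: lt_le_trans xz (rmono _ _ kn).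
have eh n : endo (h n) by have [] := HY _ (r0 n).
have near_y n : \forall z \near y n, d x z < r n /\ 3 * e / 4 < f n z.
  have [_ xy fy] := HY _ (r0 n).
  have n2 : nbhs (y n) (h n @^-1` [set w | d (h n (y n)) w < e / 4]).
    by apply: (eh n).1; apply: nbhs_bm_ball; rewrite (bm_xx hd) divr_gt0.
  apply: filterS2 (nbhs_bm_ball xy) n2 => z xz /= hz; split=> //.
  have := bm_triangle hd (h n z) (h n x) (h n (y n)).
  by rewrite (bm_sym hd (h n z)) /f; move: fy hz; rewrite -/(h n) -/(y n); lra.
(* [F z] is the larger of 0 and the supremum over even [n] of the minimum of [f n z] and all
   [e - f k z] with [k < n]. The latter terms cancel every candidate beyond an odd index [k] at
   [y k]. *)
pose S z := [set s | s <= 0 \/ exists n, [/\ ~~ odd n, s <= f n z &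
  forall k, (k < n)%N -> s <= e - f k z]].
pose F z := sup (S z).
have S_le1 z : ubound (S z) 1.
  move=> s [s0|[n [_ sf _]]]; first exact: le_trans s0 ler01.
  exact: le_trans sf (bm_le1 hd _ _).
have S_sup z : has_sup (S z).
  by split; [exists 0; left|exists 1; exact: S_le1].
have F_ge z s : S z s -> s <= F z.
  by move=> Ss; apply: ub_le_sup Ss; exact: (S_sup z).2.
have F_le z s : ubound (S z) s -> F z <= s.
  by move=> us; apply: ge_sup us; exact: (S_sup z).1.
have [|u c uc z|phi [cphi clphi]] := slow_selection hM hd (F := F).
- by move=> z; rewrite F_ge ?F_le//; left.
(* If [s] is admissible at [z], then [s - c] is admissible at [flow_act u z] with the same [n]. *)
- apply: F_le => s Ss; rewrite -lerBlDr; apply: F_ge.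
  have c0 := displacement_ge0 hd uc.
  have fc n : `|f n z - f n (flow_act u z)| <= c.
    exact: endo_displacement (eh n) uc _ _.
  case: Ss => [s0|[n [on sf sk]]]; [by left; lra|right].
  exists n; split=> // [|k kn]; first by move: (fc n); rewrite ler_norml; lra.
  by have := sk _ kn; move: (fc k); rewrite ler_norml; lra.
have phi_even n : ~~ odd n -> 3 * e / 4 <= phi (y n).
  move=> on; apply: selection_ge (clphi _) _.
  apply: filterS (near_y n) => z [xz fz]; apply: F_ge; right.
  exists n; split=> //; first exact: ltW.
  by move=> k kn; have := small _ _ _ kn xz; lra.
have phi_odd n : odd n -> phi (y n) <= e / 4.
  move=> on; apply: selection_le (clphi _) _.
  apply: filterS (near_y n) => z [xz fz]; apply: F_le => s.
  case=> [s0|[m [om sf sk]]]; first by lra.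
  (* For [m < n] the value [f m z] is small; for [n < m] the term [e - f n z] is small; parity
     excludes [m = n]. *)
  have [mn|nm|nm] := ltngtP m n; last by move: om; rewrite nm on.
    by have := small _ _ _ mn xz; lra.
  by have := sk _ nm; lra.
have : \forall z \near x, `|phi x - phi z| < e / 4.
  by move/cvgrPdist_lt: (cphi x); apply; rewrite divr_gt0.
move=> /(bm_nbhs hd)[t t0 ht].
(* The scales at least halve from [r 0 = 1]; this weaker harmonic bound is enough for them to tend
   to 0. *)
have rinv n : r n * n.+1%:R <= 1.
  elim: n => [|n IHn]; first by rewrite mulr1.
  have := rS n; have := r0 n; have : 0 <= n%:R :> R by exact: ler0n.
  move: IHn; rewrite -[n.+2]addn2 -addn1 !natrD => ? ? ? ?.
  have : r n.+1 * (n%:R + 2) <= r n / 2 * (n%:R + 2).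
    by rewrite ler_wpM2r //; lra.
  nra.
have [N rN] : exists N, r N < t.
  exists (Num.bound t^-1).
  have tN : t^-1 < (Num.bound t^-1).+1%:R.
    have /archi_boundP/lt_trans : 0 <= t^-1 by rewrite invr_ge0 ltW.
    by apply; rewrite ltr_nat.
  have := rinv (Num.bound t^-1); rewrite -ler_pdivlMr ?ltr0n // => /le_lt_trans.
  by apply; rewrite mul1r invf_plt // posrE ltr0n.
have close n : (N <= n)%N -> `|phi x - phi (y n)| < e / 4.
  move=> Nn; apply: ht; have [_ + _] := HY _ (r0 n).
  by move=> /lt_le_trans; apply; exact: le_trans (rmono _ _ Nn) (ltW rN).
(* Consecutive even and odd indices give values of [phi] at least [e / 2] apart, yet both lie
   strictly within [e / 4] of [phi x]. *)
have := close N.*2; have := close N.*2.+1; rewrite !ltr_norml.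
have NN : (N <= N.*2)%N by rewrite -addnn leq_addr.
have := phi_even N.*2; have := phi_odd N.*2.+1.
rewrite /= odd_double /= => /(_ isT) ? /(_ isT) ? /(_ (leqW NN)) ? /(_ NN).
lra.
Qed.

End EndoEquicontinuity.

(** * Density of the endomorphism orbits *)

(** The net is indexed by pairs of a neighborhood of [(z, z)] and a group element bringing [(x, y)]
    into it, ordered by reverse inclusion of neighborhoods. *)
Lemma closure_proximal_pair (G : topologicalGroupType) (X : flow G)
    (x y z : X) :
  closure (range (fun g => (flow_act g x, flow_act g y))) (z, z) ->
  proximal_pair x y.
Proof.
move=> clz.
pose I := {Vg : set (X * X) * G |
  nbhs (z, z) Vg.1 /\ Vg.1 (flow_act Vg.2 x, flow_act Vg.2 y)}.
have mkI V : nbhs (z, z) V -> exists i : I, (sval i).1 = V.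
  move=> zV; have [_ [[g _ <-] Vg]] := clz _ zV.
  by exists (exist _ (V, g) (conj zV Vg)).
exists I, (fun i j => (sval j).1 `<=` (sval i).1), (fun i => (sval i).2), z.
have conv (f : X * X -> X) : f @ (z, z) --> z ->
    (fun i : I => f (flow_act (sval i).2 x, flow_act (sval i).2 y))
      @ tails (fun i j : I => (sval j).1 `<=` (sval i).1) --> z.
  move=> cf V zV; have [i iV] := mkI _ (cf V zV).
  exists i => // j /= ji; have [_ Vj] := svalP j.
  by have := ji _ Vj; rewrite iV.
split; last 2 first.
- by apply: (conv fst); exact: cvg_fst.
- by apply: (conv snd); exact: cvg_snd.
split.
- by have [i _] := mkI setT filterT; split.
- by move=> i.
- by move=> i j k ij jk; exact: subset_trans jk ij.
- move=> i j; have [zi _] := svalP i; have [zj _] := svalP j.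
  have [k kE] := mkI _ (filterI zi zj).
  by exists k; rewrite kE; split; [exact: subIsetl|exact: subIsetr].
Qed.

Section Main.
Context (G : topologicalGroupType) (M : flow G) (hM : universal_minimal_flow M).
Context (R : realType) (d : M -> M -> R) (hd : bounded_metric d).

(** The orbit functions of [F] form a factor [Q] of [M] on which endomorphisms act trivially. A
    graph point [(m, h m)] in an orbit closure thus falls on the diagonal of [Q]; so [Q] is minimal
    and proximal, hence a point. *)
Lemma invariant_constant (F : M -> R) : strongly_amenable G -> continuous F ->
  (forall z, 0 <= F z <= 1) ->
  (forall u c, displacement_le d u c ->
    forall z, F z <= F (flow_act u z) + c) ->
  (forall h, endo h -> forall z, F (h z) = F z) ->
  forall z w, F z = F w.
Proof.
move=> [P [[_ uP] [p Pp]]] cF bF sF iF z w.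
pose Phi z g := F (flow_act g z).
have cPhi : continuous Phi.
  move=> y; apply: continuous_arrow => g.
  apply: (@continuous_comp _ _ _ (flow_act g) F); last exact: cF.
  exact: flow_act_continuous1.
have hA : flow_subset (@rtrans G R) (range Phi).
  apply: (flow_subset_slow hd).
  - apply: compact_closed.
      by apply: (@hausdorff_product {classic G} (fun=> R)) => ?; exact: Rhausdorff.
    by apply: continuous_compact (@flow_compact G M); exact: continuous_subspaceT.
  - by exists (Phi z), z.
  - by move=> _ [y _ <-]; exact: slow_orbit.
  - move=> g _ [y _ <-]; exists (flow_act g y) => //.
    by apply/funext => h; rewrite /Phi /rtrans flow_actM.
pose Q := subflow hA.
pose q y : Q := SigSub (mem_set (imageT Phi y)).
have cq : continuous q by exact: continuous_set_type.
have eq g y : q (flow_act g y) = flow_act g (q y).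
  by apply: val_inj; apply/funext => h; rewrite /= /Phi /rtrans flow_actM.
have sq (y : Q) : exists x, q x = y.
  by have [x _ xy] := set_valP y; exists x; apply: val_inj.
have iq h y : endo h -> q (h y) = q y.
  by move=> eh; apply: val_inj; apply/funext => g; rewrite /= /Phi -eh.2 iF.
have mQ : minimal Q.
  apply: stable_closed_minimal => B clB [b Bb] sB.
  have [mM _] := hM.
  have qB : q @^-1` B = setT.
    apply: (minimal_closed_stable mM).
    - by apply: preimage_closed clB => ? _; exact: cq.
    - by have [x xb] := sq b; exists x; rewrite /= xb.
    - by move=> g x /=; rewrite eq; exact: sB.
  apply/seteqP; split=> // y _; have [x <-] := sq y.
  by have : (q @^-1` B) x by rewrite qB.
have pQ : proximal Q.
  move=> a b; have [a' <-] := sq a; have [b' <-] := sq b.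
  have [m [h [eh clm]]] := closure_orbit_endo hM a' b'.
  apply: (closure_proximal_pair (z := q m)) => V Vm.
  have cqq := pair_map_continuous cq cq.
  have [|_ [[g _ <-] Vg]] := clm ((fun p => (q p.1, q p.2)) @^-1` V).
    by apply: cqq => /=; rewrite iq.
  exists (q (flow_act g a'), q (flow_act g b')); split=> //.
  by exists g; rewrite ?eq.
have [f [_ _ sf]] := uP Q (conj mQ pQ).
have Q1 y : y = f p.
  by have [x <-] := sf y; have : [set: P] x by []; rewrite Pp => ->.
have : Phi z 1%g = Phi w 1%g.
  rewrite -[Phi z]/(set_val (q z)) -[Phi w]/(set_val (q w)).
  by rewrite (Q1 (q z)) (Q1 (q w)).
by rewrite /Phi !flow_act1.
Qed.

(** The distance from [x] to the endomorphism orbit of a point is invariant, hence constant, and it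
    vanishes at [x] itself. *)
Lemma endo_orbit_dense : strongly_amenable G ->
  forall x z e, 0 < e -> exists2 h, endo h & d x (h z) < e.
Proof.
move=> hsa x z e e0.
pose S y := [set d x (h y) | h in @endo G M].
pose F y := inf (S y).
have S_inf y : has_inf (S y).
  split; first by exists (d x y), id => //; exact: endo_id.
  by exists 0 => _ [h _ <-]; exact: bm_ge0 hd _ _.
have F_le y h : endo h -> F y <= d x (h y).
  by move=> eh; apply: ge_inf; [exact: (S_inf y).2|exists h].
have F_ge y c : (forall h, endo h -> c <= d x (h y)) -> c <= F y.
  move=> cS; apply: lb_le_inf; first exact: (S_inf y).1.
  by move=> _ [h eh <-]; exact: cS.
have bF y : 0 <= F y <= 1.
  apply/andP; split; first by apply: F_ge => h _; exact: bm_ge0 hd _ _.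
  exact: le_trans (F_le y _ (endo_id M)) (bm_le1 hd _ _).
have sF u c : displacement_le d u c -> forall y, F y <= F (flow_act u y) + c.
  move=> uc y; rewrite -lerBlDr; apply: F_ge => h eh.
  have := F_le y _ eh; have := endo_displacement hd eh uc x y.
  by rewrite ler_norml; lra.
have iF h : endo h -> forall y, F (h y) = F y.
  move=> eh y; apply/eqP; rewrite eq_le; apply/andP; split; apply: F_ge => k ek.
    have [l [el hK _]] := endo_inverse hM eh.
    by have := F_le (h y) _ (endo_comp ek el); rewrite /= hK.
  exact: (F_le y _ (endo_comp ek eh)).
(* Equicontinuity lets the infimum inherit a modulus of continuity common to all [h]. *)
have cF : continuous F.
  move=> y; apply/cvgrPdist_lt => r r0.
  have r2 : 0 < r / 2 by rewrite divr_gt0.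
  have [t t0 ht] := endo_equicontinuous hM hd y r2.
  apply/(bm_nbhs hd); exists t => // w yw.
  suff : `|F y - F w| <= r / 2 by move=> /le_lt_trans; apply; lra.
  have near h : endo h -> `|d x (h y) - d x (h w)| <= r / 2.
    move=> eh; have := ht _ _ eh yw.
    have := bm_triangle hd (h w) x (h y); have := bm_triangle hd (h y) x (h w).
    by rewrite (bm_sym hd (h w)) ler_norml => ? ? ?; apply/andP; split; lra.
  rewrite ler_norml; apply/andP; split.
    suff : F w - r / 2 <= F y by lra.
    apply: F_ge => h eh; have := F_le w _ eh; have := near _ eh.
    by rewrite ler_norml; lra.
  suff : F y - r / 2 <= F w by lra.
  apply: F_ge => h eh; have := F_le y _ eh; have := near _ eh.
  by rewrite ler_norml; lra.
have Fz : F z < e.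
  rewrite (invariant_constant hsa cF bF sF iF z x).
  by apply: le_lt_trans (F_le x _ (endo_id M)) _; rewrite (bm_xx hd).
have [_ [h eh <-] hz] := inf_lt (S_inf z).1 Fz.
by exists h.
Qed.

End Main.

(** * Equicontinuity of the flow *)

Section Equicontinuous.
Context (G : topologicalGroupType) (M : flow G) (hM : universal_minimal_flow M).
Context (R : realType) (d : M -> M -> R) (hd : bounded_metric d).

Lemma endo_equicontinuous_net e : 0 < e ->
  exists s : seq M, forall z, exists2 i, (i < size s)%N &
    forall h, endo h -> d (h (nth z s i)) (h z) < e.
Proof.
move=> e0.
(* Along [F], eventually means for all finite sequences containing a given one; the covering form of
   compactness then produces the net directly. *)
pose F := filter_from [set: seq M] (fun s => [set t : seq M | {subset s <= t}]).
have FF : ProperFilter F.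
  apply: filter_from_proper => [|s _]; last by exists s.
  apply: filter_from_filter; first by exists [::].
  move=> s t _ _; exists (s ++ t) => // v stv; split=> x xs; apply: stv.
    by rewrite mem_cat xs.
  by rewrite mem_cat xs orbT.
have := (compact_near_coveringP _).1 (@flow_compact G M) _ F
  (fun s z => exists2 y, y \in s & forall h, endo h -> d (h y) (h z) < e) _.
move=> cover; have /filter_ex[s Hs] : \forall s \near F, [set: M] `<=`
    (fun z => exists2 y, y \in s & forall h, endo h -> d (h y) (h z) < e).
  apply: cover => z _; have [r r0 hr] := endo_equicontinuous hM hd z e0.
  exists ([set y | d z y < r], [set t : seq M | {subset [:: z] <= t}]) => /=.
    by split; [apply: (nbhs_bm_ball hd); rewrite (bm_xx hd)|exists [:: z]].
  move=> [y s] /= [zy zs]; exists z; first by apply: zs; rewrite inE.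
  by move=> h eh; exact: hr.
exists s => z; have [y ys hy] := Hs z Logic.I.
by exists (index y s); rewrite ?index_mem // nth_index.
Qed.

Hypothesis dense_endo : forall x z e, 0 < e -> exists2 h, endo h & d x (h z) < e.

(* Endomorphisms split into finitely many classes of uniformly close maps, one
   for each [c]; as [g] commutes with them, two points of [orb c] stay close. *)
Lemma flow_equicontinuous_metric x e : 0 < e ->
  \forall y \near x, forall g, d (flow_act g x) (flow_act g y) < e.
Proof.
move=> e0; have e6 : 0 < e / 6 by rewrite divr_gt0.
have [s Hs] := endo_equicontinuous_net e6; pose n := size s.
pose pt (i : 'I_n) := nth x s i.
have Hpt z : exists i : 'I_n, forall h, endo h -> d (h (pt i)) (h z) < e / 6.
  have [i si hi] := Hs z; exists (Ordinal si) => h eh.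
  by rewrite /pt (set_nth_default z) //; exact: hi.
(* A code records, for each net point, a net point near its image; there are finitely many. Maps
   sharing a code differ by less than four sixths of [e], and approximating the two points costs the
   remaining two. *)
pose code (c : {ffun 'I_n -> 'I_n}) h :=
  endo h /\ forall i, d (h (pt i)) (pt (c i)) < e / 6.
pose orb c := [set h x | h in code c].
have code_ex h : endo h -> exists c, code c h.
  move=> eh.
  have /fin_all_exists[c hc] (i : 'I_n) : exists j, d (h (pt i)) (pt j) < e / 6.
    have [j hj] := Hpt (h (pt i)); exists j.
    by rewrite (bm_sym hd); exact: (hj id (endo_id M)).
  by exists (finfun c); split=> // i; rewrite ffunE.
have code_close c h k : code c h -> code c k ->
    forall z, d (h z) (k z) < 4 * (e / 6).
  move=> [eh hc] [ek kc] z; have [i hi] := Hpt z.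
  have := hi _ eh; have := hi _ ek; have := hc i; have := kc i.
  have := bm_triangle hd (h (pt i)) (h z) (k z).
  have := bm_triangle hd (pt (c i)) (h (pt i)) (k z).
  have := bm_triangle hd (k (pt i)) (pt (c i)) (k z).
  rewrite (bm_sym hd (h z) (h (pt i))) (bm_sym hd (pt (c i)) (k (pt i))); lra.
(* Finitely many closed sets miss [x], so a whole neighborhood of [x] avoids them. *)
have near_orb : \forall y \near x, forall c, closure (orb c) y -> closure (orb c) x.
  apply: filter_forall => c; have [cx|ncx] := pselect (closure (orb c) x).
    by apply: nearW.
  have : nbhs x (~` closure (orb c)).
    by apply: open_nbhs_nbhs; split=> //; apply: closed_openC; exact: closed_closure.
  by apply: filterS => y.
(* The finitely many sets [orb c] together make up the dense endomorphism orbit of [x], so their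
   closures cover [M]. *)
have orb_ex y : exists c, closure (orb c) y.
  apply: contrapT => nc.
  have : \forall z \near y, forall c, ~ orb c z.
    apply: filter_forall => c.
    have : nbhs y (~` closure (orb c)).
      apply: open_nbhs_nbhs; split; last by move=> cy; apply: nc; exists c.
      by apply: closed_openC; exact: closed_closure.
    by apply: filterS => z nz oz; apply: nz; exact: subset_closure.
  move=> /(bm_nbhs hd)[r r0 hr]; have [h eh /hr no] := dense_endo y x r0.
  by have [c ch] := code_ex _ eh; apply: (no c); exists h.
apply: filterS near_orb => y orby g; have [c cy] := orb_ex y.
have approx z : closure (orb c) z ->
    exists2 h, code c h & d (flow_act g z) (flow_act g (h x)) < e / 6.
  move=> cz; have [] := cz (flow_act g @^-1` [set w | d (flow_act g z) w < e / 6]).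
    by apply: flow_act_continuous1; apply: (nbhs_bm_ball hd); rewrite (bm_xx hd).
  by move=> _ [[h ch <-] hz]; exists h.
have [h ch hx] := approx x (orby _ cy); have [k ck ky] := approx y cy.
have := code_close _ _ _ ch ck (flow_act g x).
rewrite ch.1.2 ck.1.2 => hk.
have := bm_triangle hd (flow_act g (h x)) (flow_act g x) (flow_act g y).
have := bm_triangle hd (flow_act g (k x)) (flow_act g (h x)) (flow_act g y).
by rewrite (bm_sym hd (flow_act g (k x))); lra.
Qed.

(** A Lebesgue number argument: near each [y], two steps of [B] through [y] stay in [E], and
    compactness makes the radius uniform. *)
Lemma uniformity_bm (U : set_system (M * M)) (E : set (M * M)) :
  is_uniformity U -> U E ->
  exists2 e, 0 < e & forall y z, d y z < e -> E (y, z).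
Proof.
move=> [FU _ invU splitU nbhsU] UE; have [B UB BE] := splitU _ UE.
have := (compact_near_coveringP _).1 (@flow_compact G M) R (0^'+)
  (fun e y => forall z, d y z < e -> E (y, z)) _.
move=> cover; have near_e : \forall e \near 0^'+, [set: M] `<=`
    (fun y => forall z, d y z < e -> E (y, z)).
  apply: cover => y _.
  have /(bm_nbhs hd)[r r0 hr] : nbhs y [set z | (B `&` B^-1%relation) (y, z)].
    rewrite nbhsU; exists (B `&` B^-1%relation).
      by apply: filterI => //; exact: invU.
    by move=> z; rewrite /xsection /= inE.
  have r2 : 0 < r / 2 by rewrite divr_gt0.
  exists ([set z | d y z < r / 2], [set e | e < r / 2]) => /=.
    split; first by apply: (nbhs_bm_ball hd); rewrite (bm_xx hd).
    exact: nbhs_right_lt.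
  move=> [w e] /= [yw er] z wz; apply: BE; exists y.
    by have [|_] := hr w; first lra.
  have [|//] := hr z; have := bm_triangle hd w y z; lra.
have : \forall e \near (0 : R)^'+, 0 < e /\ forall y z, d y z < e -> E (y, z).
  near=> e; split; first by near: e; exact: nbhs_right_gt.
  move=> y z; have : [set: M] `<=` (fun y => forall z, d y z < e -> E (y, z)).
    by near: e.
  by move=> /(_ y Logic.I); exact.
by move=> /filter_ex[e [e0 He]]; exists e.
Unshelve. all: by end_near. Qed.

Lemma flow_equicontinuous : equicontinuous_flow M.
Proof.
move=> U hU x E UE; have [e e0 He] := uniformity_bm hU UE.
by apply: filterS (flow_equicontinuous_metric x e0) => y Hy g; apply: He.
Qed.

End Equicontinuous.

Theorem theorem1 (R : realType) (G : topologicalGroupType) (hG : polish R G)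
  (M : flow G) (hM : universal_minimal_flow M) (hMmetr : metrizable R M)
  (hsa : strongly_amenable G) (hmap : minimally_almost_periodic G) :
  extremely_amenable G.
Proof.
have [d hd] := metrizable_bounded hMmetr.
have [B [[_ uB] [b Bb]]] := hmap; have [mM _] := hM.
have eM := flow_equicontinuous hM hd (endo_orbit_dense hM hd hsa).
have [q [_ _ sq]] := uB M (conj mM eM).
have M1 y : y = q b.
  by have [x <-] := sq y; have : [set: B] x by []; rewrite Bb => ->.
(* [M] is now a single point, and its image under an equivariant map to [X] is fixed. *)
move=> X; have [|f [_ ef _]] := universal_map (act := @flow_act G X) (A := setT) hM.
  by apply: flow_subset_closed; [exact: closedT|exact: flow_nonempty|].
by exists (f (q b)) => g; rewrite -ef; congr f; exact: M1.
Qed.
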